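(* Let $G$ be an undirected loop-free graph on $n\ge2$ vertices with adjacency matrix $A=A(G)$. Then $$\lambda^S_G(A)=\begin{cases}-\Delta(G), & \Delta(G)<n/2,\\ -n/2, & \delta(G)\le n/2\le\Delta(G),\\ \delta(G)-n, & \delta(G)>n/2,\end{cases}$$ and $$\widetilde\lambda(A)=\begin{cases}-\Delta_2(G), & \Delta_2(G)<n/2,\\ -n/2, & \delta_2(G)\le n/2\le\Delta_2(G),\\ \delta_2(G)-n, & \delta_2(G)>n/2.\end{cases}$$
   Context: The adjacency matrix of a graph with vertex set $\{1,\dots,n\}$ has $A_{ij}=1$ if $i$ and $j$ are adjacent and $0$ otherwise (zero diagonal). The degree of a vertex is the number of vertices adjacent to it. $\Delta(G)$ and $\delta(G)$ are the largest and smallest degrees of $G$; $\Delta_2(G)$ is the average of the two largest degrees and $\delta_2(G)$ the average of the two smallest degrees, the degrees of all $n$ vertices being listed with multiplicity. $\mathbf 1$ is the $n\times n$ matrix with all entries $1$, and $R_i(B)=\sum_{j\ne i}|b_{ij}|$ for an $n\times n$ matrix $B=(b_{ij})$. The shifted Gershgorin lower bound is $$\lambda^S_G(A)=\sup_{x\ge0}\min_i\Bigl(a_{ii}-x-\sum_{j\ne i}|a_{ij}-x|\Bigr)$$ (the subscript $G$ in $\lambda^S_G$ stands for Gershgorin, not for the graph), and, for a matrix with zero diagonal, $$\widetilde\lambda(A)=\sup_{x\ge0}\min_{i\ne j}\Bigl(-x-\tfrac12\bigl(R_i(A-x\mathbf 1)+R_j(A-x\mathbf 1)\bigr)\Bigr).$$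 *)

(* Defs.v *)
From HB Require Import structures.
From mathcomp Require Import all_boot all_order all_algebra.
From mathcomp Require Import all_classical all_reals all_analysis.

Set Implicit Arguments.
Unset Strict Implicit.
Unset Printing Implicit Defensive.

Import Order.TTheory GRing.Theory Num.Theory.

Local Open Scope classical_set_scope.
Local Open Scope ring_scope.

(* Graphs on 'I_n are given by their adjacency relation e : rel 'I_n, assumed
   symmetric and irreflexive where needed. *)

Definition adjmx (R : realType) (n : nat) (e : rel 'I_n) : 'M[R]_n :=
  \matrix_(i, j) (e i j)%:R.

Definition degree (n : nat) (e : rel 'I_n) (i : 'I_n) : nat :=
  #|[set j | e i j]%SET|.

Definition max_degree (n : nat) (e : rel 'I_n) : nat :=
  (\max_(i < n) degree e i)%N.

(* The initial value n is harmless: an irreflexive e has all degrees < n. *)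
Definition min_degree (n : nat) (e : rel 'I_n) : nat :=
  \big[minn/n]_(i < n) degree e i.

Definition degrees (n : nat) (e : rel 'I_n) : seq nat :=
  [seq degree e i | i <- enum 'I_n].

Definition max_degree2 (R : realType) (n : nat) (e : rel 'I_n) : R :=
  let s := sort geq (degrees e) in (nth 0%N s 0 + nth 0%N s 1)%:R / 2.

Definition min_degree2 (R : realType) (n : nat) (e : rel 'I_n) : R :=
  let s := sort leq (degrees e) in (nth 0%N s 0 + nth 0%N s 1)%:R / 2.

Definition offdiag_sum (R : realType) (n : nat) (B : 'M[R]_n) (i : 'I_n) : R :=
  \sum_(j < n | j != i) `|B i j|.

(* Both bounds take values in \bar R so that the finite minimum and the
   supremum need no default value. *)

Definition shifted_gershgorin (R : realType) (n : nat) (A : 'M[R]_n) : \bar R :=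
  ereal_sup [set \big[mine/+oo%E]_(i < n)
                   (A i i - x - \sum_(j < n | j != i) `|A i j - x|)%:E
            | x in [set x : R | 0 <= x]].

(* Meant for matrices with zero diagonal. *)
Definition lambda_tilde (R : realType) (n : nat) (A : 'M[R]_n) : \bar R :=
  ereal_sup [set \big[mine/+oo%E]_(p : 'I_n * 'I_n | p.1 != p.2)
                   (- x - 2^-1 * (offdiag_sum (A - x *: const_mx 1) p.1
                                  + offdiag_sum (A - x *: const_mx 1) p.2))%:E
            | x in [set x : R | 0 <= x]].

(* Main.v *)
Require Import Defs.
From HB Require Import structures.
From mathcomp Require Import all_boot all_order all_algebra.
From mathcomp Require Import all_classical all_reals all_analysis.
From mathcomp Require Import lra.

Set Implicit Arguments.
Unset Strict Implicit.
Unset Printing Implicit Defensive.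

Import Order.TTheory GRing.Theory Num.Theory.

Local Open Scope ring_scope.

(** Subtracting [x >= 0] from every entry of the adjacency matrix turns the
    Gershgorin bound of a row of degree [d] into
    [radial_bound n d x = - (n - d) * x - d * `|1 - x|]: the diagonal entry
    contributes [- x] exactly like a non-neighbour.  This expression is affine in
    [d], so the average of the bounds of two rows is again [radial_bound n d x],
    with [d] the average of their degrees.  Both halves of the theorem are
    therefore instances of one max-min problem (lemma [sup_min_radial_bound]):
    maximise over [x >= 0] the minimum of [radial_bound n d x] when [d] ranges
    over a finite family of reals with smallest value [m] and largest value [M].

    As a function of [x], the bound goes linearly from [- d] at [0] to [d - n] at
    [1] and then decreases with slope [- n]; at [1/2] it equals [- n / 2] whatever
    [d] is.  The best shift is thus [0] if all slopes [2 * d - n] between [0] and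
    [1] are negative, [1] if they are all positive, and otherwise [1/2], because
    the member [M] of the family bounds the minimum by [- n / 2] before [1/2] and
    the member [m] does so after it.

    It remains to identify [m] and [M]: for single rows they are the extreme
    degrees, and for pairs of distinct rows they are the averages of the first two
    entries of the sorted degree list (lemma [sort_two_first]). *)

(** * The max-min problem *)

Section MaxMin.
Local Open Scope classical_set_scope.
Variable R : realType.

Definition radial_bound (n d x : R) : R := - (n - d) * x - d * `|1 - x|.

Lemma radial_bound_le1 (n d x : R) :
  x <= 1 -> radial_bound n d x = - d + x * (2 * d - n).
Proof. by move=> x1; rewrite /radial_bound ger0_norm ?subr_ge0//; lra. Qed.

Lemma radial_bound_ge1 (n d x : R) :
  1 <= x -> radial_bound n d x = d - n * x.
Proof. by move=> x1; rewrite /radial_bound ler0_norm ?subr_le0//; lra. Qed.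

Lemma radial_bound_le_start (n d x : R) : 0 <= n -> 0 <= x -> d <= n / 2 ->
  radial_bound n d x <= - d.
Proof.
move=> n0 x0 dn; have [x1|/ltW x1] := leP x 1.
  by rewrite radial_bound_le1//; nra.
by rewrite radial_bound_ge1//; nra.
Qed.

Lemma radial_bound_le_end (n d x : R) : 0 <= n -> n / 2 <= d ->
  radial_bound n d x <= d - n.
Proof.
move=> n0 dn; have [x1|/ltW x1] := leP x 1.
  by rewrite radial_bound_le1//; nra.
by rewrite radial_bound_ge1//; nra.
Qed.

Lemma radial_bound_le_before_half (n d x : R) : n / 2 <= d -> x <= 2^-1 ->
  radial_bound n d x <= - (n / 2).
Proof. by move=> dn x2; rewrite radial_bound_le1; [nra | lra]. Qed.

Lemma radial_bound_le_after_half (n d x : R) : 0 <= n -> d <= n / 2 ->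
  2^-1 <= x -> radial_bound n d x <= - (n / 2).
Proof.
move=> n0 dn x2; have [x1|/ltW x1] := leP x 1.
  by rewrite radial_bound_le1//; nra.
by rewrite radial_bound_ge1//; nra.
Qed.

Lemma ereal_sup_min_eq (T : finType) (P : pred T) (F : R -> T -> R) (c : R) :
  (forall x, 0 <= x -> exists2 k, P k & F x k <= c) ->
  (exists2 x, 0 <= x & forall k, P k -> c <= F x k) ->
  ereal_sup [set \big[mine/+oo%E]_(k | P k) (F x k)%:E | x in [set x : R | 0 <= x]]
  = c%:E.
Proof.
move=> ub [y y0 lb]; apply/eqP; rewrite eq_le; apply/andP; split.
  apply: ge_ereal_sup => _ [x /= x0 <-].
  have [k Pk Fk] := ub x x0.
  by apply: bigmin_inf Pk _; rewrite lee_fin.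
apply: (@le_trans _ _ (\big[mine/+oo%E]_(k | P k) (F y k)%:E)%E).
  by apply: le_bigmin => [|k Pk]; rewrite ?leey// lee_fin lb.
by apply: ereal_sup_ubound; exists y.
Qed.

(** The family of bounds is an arbitrary [F], because the expressions built from
    the matrix agree with [radial_bound] only for [x >= 0].  The shifts [0],
    [1/2] and [1] attain the three values. *)
Lemma sup_min_radial_bound (T : finType) (P : pred T) (d : T -> R)
    (F : R -> T -> R) (n : R) (km kM : T) :
  0 <= n ->
  (forall x k, 0 <= x -> P k -> F x k = radial_bound n (d k) x) ->
  P km -> (forall k, P k -> d km <= d k) ->
  P kM -> (forall k, P k -> d k <= d kM) ->
  let S := ereal_sup [set \big[mine/+oo%E]_(k | P k) (F x k)%:E
                     | x in [set x : R | 0 <= x]] in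
  [/\ d kM < n / 2 -> S = (- d kM)%:E,
      d km <= n / 2 -> n / 2 <= d kM -> S = (- (n / 2))%:E
    & n / 2 < d km -> S = (d km - n)%:E].
Proof.
move=> n0 FE Pm dm PM dM S.
split=> [Mn|mn nM|nm]; apply: ereal_sup_min_eq.
- move=> x x0; exists kM => //; rewrite FE//.
  by apply: radial_bound_le_start => //; exact: ltW.
- exists 0 => // k Pk; rewrite FE// radial_bound_le1//.
  by have := dM _ Pk; lra.
- move=> x x0; have [x2|/ltW x2] := leP x 2^-1.
    by exists kM => //; rewrite FE// radial_bound_le_before_half.
  by exists km => //; rewrite FE// radial_bound_le_after_half.
- exists 2^-1 => [|k Pk]; first by rewrite invr_ge0.
  by rewrite FE ?invr_ge0// radial_bound_le1; lra.
- move=> x x0; exists km => //; rewrite FE//.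
  by apply: radial_bound_le_end => //; exact: ltW.
- exists 1 => // k Pk; rewrite FE// radial_bound_le1//.
  by have := dm _ Pk; lra.
Qed.

End MaxMin.

(** * Rows of the shifted adjacency matrix *)

(** Since [e i i] is false, the leading [- x] is the term that the sum over
    [j != i] leaves out, and the left-hand side is minus a sum over all [j]. *)
Lemma adjmx_row_bound (R : realType) (n : nat) (e : rel 'I_n) (i : 'I_n) (x : R) :
  irreflexive e -> 0 <= x ->
  - x - \sum_(j < n | j != i) `|adjmx R e i j - x| =
  radial_bound n%:R (degree e i)%:R x.
Proof.
move=> e_irr x0.
have -> : - x - \sum_(j < n | j != i) `|adjmx R e i j - x| =
          - \sum_(j < n) `|adjmx R e i j - x|.
  by rewrite [in RHS](bigD1 i)//= mxE e_irr sub0r normrN ger0_norm// opprD.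
have -> : \sum_(j < n) `|adjmx R e i j - x| =
          \sum_(j < n) (x + (e i j)%:R * (`|1 - x| - x)).
  apply: eq_bigr => j _; rewrite mxE; case: (e i j) => /=.
    by rewrite mul1r [RHS]addrC subrK.
  by rewrite mul0r addr0 sub0r normrN ger0_norm.
rewrite big_split/= -mulr_suml -natr_sum sumr_const card_ord -mulr_natl.
have -> : (\sum_(j < n) e i j)%N = degree e i.
  by rewrite /degree -sum1dep_card [RHS]big_mkcond; apply: eq_bigr => j _; case: (e i j).
by rewrite /radial_bound; lra.
Qed.

(** * Extreme degrees *)

Lemma max_degree_attained (n : nat) (e : rel 'I_n) : (0 < n)%N ->
  exists2 i, max_degree e = degree e i & forall j, (degree e j <= degree e i)%N.
Proof.
move=> n0.
have [|i di] := bigop.eq_bigmax (degree e); first by rewrite card_ord.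
by exists i => // j; rewrite -di; exact: leq_bigmax.
Qed.

Lemma min_degree_attained (n : nat) (e : rel 'I_n) : (0 < n)%N ->
  exists2 i, min_degree e = degree e i & forall j, (degree e i <= degree e j)%N.
Proof.
move=> n0; have i0 : 'I_n := Ordinal n0.
case: (@arg_minnP _ i0 xpredT (degree e) isT) => i _ di.
exists i => [|j]; last exact: di.
have dn : (degree e i <= n)%N by rewrite -[leqRHS]card_ord max_card.
apply/eqP; rewrite /min_degree eqn_leq; apply/andP; split.
  by rewrite -minEnat -leEnat; exact: bigmin_le.
by rewrite -minEnat -leEnat; apply: le_bigmin => // j _; exact: di.
Qed.

(** Sorting the indices by their values, rather than the values, keeps track of
    the two positions when several values coincide. *)
Lemma sort_two_first (n : nat) (f : 'I_n -> nat) (r : rel nat) :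
  (2 <= n)%N -> total r -> transitive r ->
  let s := sort r [seq f i | i <- enum 'I_n] in
  exists i j, [/\ i != j, nth 0%N s 0 = f i, nth 0%N s 1 = f j,
    forall k, r (f i) (f k) & forall k, k != i -> r (f j) (f k)].
Proof.
move=> n2 r_tot r_tr s; rewrite {}/s sort_map.
set t := sort _ _.
have sz_t : size t = n by rewrite size_sort size_enum_ord.
have uniq_t : uniq t by rewrite sort_uniq enum_uniq.
have mem_t k : k \in t by rewrite mem_sort mem_enum.
have : sorted (relpre f r) t by apply: sort_sorted => x y; exact: r_tot.
case: t sz_t uniq_t mem_t => [|i [|j t]]; rewrite /= => sz_t; try by rewrite -sz_t in n2.
move=> /andP[it _] mem_t /andP[rij jt].
have rr x : r x x by have := r_tot x x; rewrite orbb.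
have r_j k : k != i -> r (f j) (f k).
  move=> ki; have := mem_t k; rewrite !inE (negPf ki)/= => /predU1P[->//|kt].
  have tr : transitive (relpre f r) by move=> ? ? ?; exact: r_tr.
  by have /allP/(_ k kt) := order_path_min tr jt.
exists i, j; split=> //; first by move: it; rewrite inE => /norP[].
by move=> k; have [->//|/r_j] := eqVneq k i; apply: r_tr.
Qed.

(** In a pair [k != l] at least one index differs from the first sorted index
    [i], so its degree is at least that of the second one [j]. *)
Lemma min_degree2_attained (R : realType) (n : nat) (e : rel 'I_n) : (2 <= n)%N ->
  exists i j, [/\ i != j, min_degree2 R e = (degree e i + degree e j)%:R / 2
    & forall k l, k != l -> (degree e i + degree e j <= degree e k + degree e l)%N].
Proof.
move=> n2.
have [i [j [ij si sj ri rj]]] := sort_two_first (degree e) n2 leq_total leq_trans.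
exists i, j; split=> //; first by rewrite /min_degree2 /degrees si sj.
move=> k l kl; have [ki|ki] := eqVneq k i.
  by rewrite leq_add// rj// -ki eq_sym.
by rewrite addnC leq_add// rj.
Qed.

Lemma max_degree2_attained (R : realType) (n : nat) (e : rel 'I_n) : (2 <= n)%N ->
  exists i j, [/\ i != j, max_degree2 R e = (degree e i + degree e j)%:R / 2
    & forall k l, k != l -> (degree e k + degree e l <= degree e i + degree e j)%N].
Proof.
move=> n2.
have geq_total : total geq by move=> x y; exact: leq_total.
have geq_trans : transitive geq by move=> y x z /= yx zy; exact: leq_trans zy yx.
have [i [j [ij si sj ri rj]]] := sort_two_first (degree e) n2 geq_total geq_trans.
exists i, j; split=> //; first by rewrite /max_degree2 /degrees si sj.
move=> k l kl; have [ki|ki] := eqVneq k i.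
  by apply: leq_add; [exact: ri | apply: rj; rewrite -ki eq_sym].
by rewrite addnC; apply: leq_add; [exact: ri | exact: rj].
Qed.

Theorem mainTheorem5 (R : realType) (n : nat) (e : rel 'I_n)
    (n_ge2 : (2 <= n)%N) (e_sym : symmetric e) (e_irr : irreflexive e) :
  [/\ (max_degree e)%:R < n%:R / 2 :> R ->
        shifted_gershgorin (adjmx R e) = (- (max_degree e)%:R)%:E,
      (min_degree e)%:R <= n%:R / 2 :> R -> n%:R / 2 <= (max_degree e)%:R :> R ->
        shifted_gershgorin (adjmx R e) = (- (n%:R / 2))%:E
    & (min_degree e)%:R > n%:R / 2 :> R ->
        shifted_gershgorin (adjmx R e) = ((min_degree e)%:R - n%:R)%:E]
  /\
  [/\ max_degree2 R e < n%:R / 2 ->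
        lambda_tilde (adjmx R e) = (- max_degree2 R e)%:E,
      min_degree2 R e <= n%:R / 2 -> n%:R / 2 <= max_degree2 R e ->
        lambda_tilde (adjmx R e) = (- (n%:R / 2))%:E
    & min_degree2 R e > n%:R / 2 ->
        lambda_tilde (adjmx R e) = (min_degree2 R e - n%:R)%:E].
Proof.
have n_gt0 : (0 < n)%N by exact: ltnW.
split.
  have [i -> mi] := min_degree_attained e n_gt0.
  have [j -> Mj] := max_degree_attained e n_gt0.
  apply: (@sup_min_radial_bound R _ xpredT (fun k => (degree e k)%:R)) => //.
  - by move=> x k x0 _; rewrite -adjmx_row_bound// [adjmx R e k k]mxE e_irr sub0r.
  - by move=> k _; rewrite ler_nat.
  - by move=> k _; rewrite ler_nat.
have [i [i' [ii' -> mi]]] := min_degree2_attained R e n_ge2.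
have [j [j' [jj' -> Mj]]] := max_degree2_attained R e n_ge2.
apply: (@sup_min_radial_bound R _ (fun p : 'I_n * 'I_n => p.1 != p.2)
  (fun p => (degree e p.1 + degree e p.2)%:R / 2) _ _ (i, i') (j, j')) => //.
- move=> x [k l] x0 _ /=.
  have offdiagE p : offdiag_sum (adjmx R e - x *: const_mx 1) p =
                    - x - radial_bound n%:R (degree e p)%:R x.
    rewrite -adjmx_row_bound// subKr; apply: eq_bigr => q _.
    by rewrite !mxE mulr1.
  by rewrite !offdiagE natrD /radial_bound; lra.
- by move=> [k l] /= kl; rewrite ler_pM2r ?invr_gt0// ler_nat mi.
- by move=> [k l] /= kl; rewrite ler_pM2r ?invr_gt0// ler_nat Mj.
Qed.
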